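(* Consider the linear dynamical network $\dot x = Ax+Bu$ with $A\in\mathbb{R}^{N\times N}$, $B\in\mathbb{R}^{N\times M}$, where each column of $B$ has exactly one nonzero entry, and nodes $\mathcal{V}=\{v_1,\dots,v_N\}$. Let $\mathcal{C}\subseteq\mathcal{V}$ denote the set of controllable nodes, i.e. the maximal set of nodes that are simultaneously controllable. The following two facts hold true: (i) $|\mathcal{C}|$ always coincides with the dimension of the controllable subspace of the pair $(A,B)$; (ii) the set $\mathcal{C}$ is not unique.
   Context: The network has nodes $v_1,\dots,v_N$; the scalar $x_i$ (the $i$-th component of $x\in\mathbb{R}^N$) is the state of node $v_i$, $A$ encodes the intrinsic node dynamics (diagonal entries) and the network edges (for $i\neq j$, $a_{ij}\neq 0$ iff there is an edge from $v_j$ to $v_i$), and $B$ encodes into which nodes (the drivers) the input signals $u\in\mathbb{R}^M$ are injected. A node $v_j$ is controllable iff it is possible to steer the value of its state $x_j$ from any initial condition to any target value with a suitable selection of the control signals $u$ in finite time. A set of nodes $\mathcal{S}$ is simultaneously controllable iff, from any initial condition $x(0)\in\mathbb{R}^N$ and for any assignment of target values $(\bar x_i)_{i: v_i\in\mathcal{S}}$, there exist a control $u$ and a finite time at which $x_i=\bar x_i$ for all $i$ with $v_i\in\mathcal{S}$ (no requirement being imposed on the other nodes). The set of controllable nodes $\mathcal{C}$ is the maximal (in cardinality) set of nodes that are simultaneously controllable. The controllable subspace of $(A,B)$ is the column space of $K=[B\ AB\ \cdots\ A^{N-1}B]$. *)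

(* Defs.v *)
From HB Require Import structures.
From mathcomp Require Import all_boot all_order all_algebra.
From mathcomp Require Import all_classical all_reals all_analysis.
Import Order.TTheory GRing.Theory Num.Theory.
Import numFieldNormedType.Exports.

Set Implicit Arguments.
Unset Strict Implicit.
Unset Printing Implicit Defensive.

Local Open Scope classical_set_scope.
Local Open Scope ring_scope.

Section Network.
Context {R : realType} {N M : nat}.
Variables (A : 'M[R]_N) (B : 'M[R]_(N, M)).

Definition one_nonzero_per_column : Prop :=
  forall j : 'I_M, #|[set i : 'I_N | B i j != 0]%SET| = 1%N.

(* The controls are the signals that are continuous except at finitely many
   instants (collected in [D]); the state is continuous on the whole of [0, T]
   and satisfies the differential equation off [D]. Given [u] and [x 0], the
   values of [x] on [0, T] are thus determined. *)
Definition trajectory (T : R) (u : R -> 'cV[R]_M) (x : R -> 'cV[R]_N) : Prop :=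
  (forall i, {within `[0, T], continuous (fun t => x t i 0)}) /\
  exists D : seq R, forall t, t \in `]0, T[ -> t \notin D ->
    (forall j, {for t, continuous (fun s => u s j 0)}) /\
    (forall i, is_derive t 1 (fun s => x s i 0)
                 ((A *m x t + B *m u t) i 0)).

Definition simultaneously_controllable (S : {set 'I_N}) : Prop :=
  forall x0 xbar : 'cV[R]_N,
  exists (u : R -> 'cV[R]_M) (T : R) (x : R -> 'cV[R]_N),
    [/\ 0 <= T, trajectory T u x, x 0 = x0 &
        forall i, i \in S -> x T i 0 = xbar i 0].

(* Maximality is in cardinality, not for inclusion. Several sets may qualify,
   hence a predicate. *)
Definition controllable_nodes (C : {set 'I_N}) : Prop :=
  simultaneously_controllable C /\
  forall S, simultaneously_controllable S -> (#|S| <= #|C|)%N.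

Definition controllability_matrix : 'M[R]_(N, \sum_(k < N) M) :=
  \mxrow_(k < N) (A ^+ k *m B).

Definition controllable_subspace : {vspace 'cV[R]_N} :=
  <<[seq col j controllability_matrix | j : 'I_(\sum_(k < N) M)]>>%VS.

End Network.

(* Main.v *)
Require Import Defs.
From HB Require Import structures.
From mathcomp Require Import all_boot all_order all_algebra.
From mathcomp Require Import all_classical all_reals all_analysis.
From mathcomp Require Import zify ring.
Import Order.TTheory GRing.Theory Num.Theory.
Import numFieldNormedType.Exports.

Set Implicit Arguments.
Unset Strict Implicit.
Unset Printing Implicit Defensive.

Local Open Scope classical_set_scope.
Local Open Scope ring_scope.

(** Write K for the controllability matrix, so that the dimension in (i) is the
    rank of K. The set S is simultaneously controllable if and only if the rows
    of K indexed by S are linearly independent; both facts follow, since a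
    matrix has as many independent rows as its rank, and usually several choices
    of them.

    Independence is necessary. If a row vector v supported on S satisfies
    v K = 0, then v A^k B = 0 for every k by Cayley-Hamilton, hence
    v e^(sA) B = 0 for every s. Along any trajectory the quantity
    v e^((T-t)A) x(t) therefore has derivative zero off a finite set of
    instants, whatever the control, so that v x(T) = v e^(TA) x(0)
    ([trajectory_autonomous]). Starting from x(0) = 0 and aiming at the target v
    forces the sum of the squares of the entries of v to vanish
    ([controllable_indep]).

    Independence is sufficient. If the rows of K indexed by S are independent,
    every assignment of values on S is the restriction of some xi in the range
    of K. By superposition with the free motion e^(tA) x(0), it is enough to
    steer the system from 0 to xi in time 1 ([steer]), and this can be done with
    polynomial controls, without the controllability Gramian. Differentiating a
    trajectory gives a trajectory again; hence, if high-order contact with 0 at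
    t = 0 is demanded of the polynomial trajectories, the states that they reach
    are stable under A as soon as they contain the range of B
    ([poly_reachable_step]). A vector B w is reached by a trajectory built, as
    for flat systems, from one scalar polynomial phi and its derivatives
    ([poly_reachable_input]).

    For (ii), let a driver node feed two identical nodes: they cannot be
    controlled together, but each of them can be controlled together with the
    driver. *)

(** * Entrywise limits and derivatives *)

Section Entrywise.
Context {R : realType}.

Lemma cvg_sumr (T I : Type) (F : set_system T) {FF : Filter F} (s : seq I)
    (f : I -> T -> R) (l : I -> R) :
  (forall i, f i @ F --> l i) ->
  (fun t => \sum_(i <- s) f i t) @ F --> \sum_(i <- s) l i.
Proof.
move=> fl; elim: s => [|i s IHs].
  rewrite big_nil; under eq_fun do rewrite big_nil; exact: cvg_cst.
rewrite big_cons; under eq_fun do rewrite big_cons; exact: cvgD.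
Qed.

Lemma cvg_mulmxl (T : Type) (F : set_system T) {FF : Filter F} m n p
    (P : 'M[R]_(m, n)) (f : T -> 'M[R]_(n, p)) (l : 'M[R]_(n, p)) :
  (forall i j, (fun t => f t i j) @ F --> l i j) ->
  forall i j, (fun t => (P *m f t) i j) @ F --> (P *m l) i j.
Proof.
move=> fl i j; rewrite mxE; under eq_fun do rewrite mxE.
by apply: cvg_sumr => k; apply: cvgM; [exact: cvg_cst|exact: fl].
Qed.

Lemma cvg_mulmxr (T : Type) (F : set_system T) {FF : Filter F} m n p
    (f : T -> 'M[R]_(m, n)) (l : 'M[R]_(m, n)) (Q : 'M[R]_(n, p)) :
  (forall i j, (fun t => f t i j) @ F --> l i j) ->
  forall i j, (fun t => (f t *m Q) i j) @ F --> (l *m Q) i j.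
Proof.
move=> fl i j; rewrite mxE; under eq_fun do rewrite mxE.
by apply: cvg_sumr => k; apply: cvgM; [exact: fl|exact: cvg_cst].
Qed.

Lemma is_derive_sumr n (f : 'I_n -> R -> R) (df : 'I_n -> R) (t : R) :
  (forall i, is_derive t 1 (f i) (df i)) ->
  is_derive t 1 (fun t => \sum_(i < n) f i t) (\sum_(i < n) df i).
Proof.
move=> fd; have := is_derive_sum fd.
by congr (is_derive _ _ _ _); apply/funext => s; rewrite fct_sumE.
Qed.

Lemma is_derive_continuous (f : R -> R) (df t : R) :
  is_derive t 1 f df -> {for t, continuous f}.
Proof.
by move=> [fd _]; apply: differentiable_continuous; apply/derivable1_diffP.
Qed.

End Entrywise.

Arguments cvg_mulmxl {R T F FF m n p} P {f l} _ i j.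
Arguments cvg_mulmxr {R T F FF m n p f l} Q _ i j.

(** * The matrix exponential *)

Section MatrixExponential.
Context {R : realType} {n : nat}.
Implicit Types (A : 'M[R]_n) (t : R).

(** The entries of e^(tA) are defined as scalar power series, so that the
    differentiation theorem for such series applies to each of them. *)
Definition expmx A t : 'M[R]_n :=
  \matrix_(i, j) limn (pseries (fun k => (A ^+ k) i j / k`!%:R) t).

(** Differentiating the series of e^(tA) termwise only shifts the exponent of A;
    the shift [m] lets one convergence lemma serve for the series and for its
    successive derivatives. *)
Definition expmx_coef A m i j k : R := (A ^+ (m + k)) i j / k`!%:R.

Lemma pseries_diffs_expmx A m i j :
  pseries_diffs (expmx_coef A m i j) = expmx_coef A m.+1 i j.
Proof.
apply/funext => k; rewrite /pseries_diffs /expmx_coef addSnnS mulrCA.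
by rewrite factS natrM invfM mulVKf.
Qed.

(** By induction on the exponent, because the sum of the absolute values of all
    the entries bounds that of each row. This is what compares the series of
    e^(tA) with the scalar exponential series. *)
Lemma norm_powmx_entry A k i j :
  `|(A ^+ k) i j| <= (\sum_i \sum_j `|A i j|) ^+ k.
Proof.
set c := \sum_i _.
elim: k i j => [|k IHk] i j.
  by rewrite expr0 mxE; case: eqP; rewrite ?normr1 ?normr0.
rewrite exprS -mulmxE mxE.
apply: (le_trans (ler_norm_sum _ _ _)).
have : \sum_k0 `|A i k0 * (A ^+ k) k0 j| <= \sum_k0 `|A i k0| * c ^+ k.
  by apply: ler_sum => l _; rewrite normrM ler_wpM2l.
move/le_trans; apply; rewrite -mulr_suml exprS; apply: ler_wpM2r.
  by apply: exprn_ge0; apply: sumr_ge0 => ? _; apply: sumr_ge0.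
rewrite /c [leRHS](bigD1 i)//= lerDl.
by apply: sumr_ge0 => ? _; apply: sumr_ge0.
Qed.

Lemma is_cvg_expmx A m i j t : cvgn (pseries (expmx_coef A m i j) t).
Proof.
set c : R := \sum_i \sum_j `|A i j|.
have c0 : 0 <= c by apply: sumr_ge0 => ? _; apply: sumr_ge0.
apply: normed_cvg.
apply: (@series_le_cvg _ _ (fun k => c ^+ m * exp_coeff (c * `|t|) k)).
- by move=> k; rewrite normr_ge0.
- by move=> k; rewrite mulr_ge0 ?exprn_ge0// exp_coeff_ge0// mulr_ge0.
- move=> k /=; rewrite /expmx_coef !normrM normrX normfV normr_nat.
  rewrite /exp_coeff /= exprMn mulrA (mulrA (c ^+ m)) -exprD mulrAC.
  rewrite ler_wpM2r ?invr_ge0// ler_wpM2r ?exprn_ge0//.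
  exact: norm_powmx_entry.
- exact/is_cvg_seriesZ/is_cvg_series_exp_coeff.
Qed.

(** Partial sums kept as matrices: algebraic identities are checked on them,
    then passed to the limit. *)
Definition expmx_partial A t N : 'M[R]_n :=
  \sum_(0 <= k < N) (t ^+ k / k`!%:R) *: A ^+ k.

Lemma expmx_partialE A m t N i j :
  (A ^+ m *m expmx_partial A t N) i j = pseries (expmx_coef A m i j) t N.
Proof.
rewrite /pseries /series /= /expmx_partial mulmx_sumr summxE.
apply: eq_bigr => k _; rewrite -scalemxAr mxE mulmxE -exprD /expmx_coef.
by rewrite mulrC mulrA mulrAC.
Qed.

Lemma cvg_expmx_partial A t i j :
  (fun N => expmx_partial A t N i j) @ \oo --> expmx A t i j.
Proof.
have -> : (fun N => expmx_partial A t N i j) = pseries (expmx_coef A 0 i j) t.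
  by apply/funext => N; rewrite -expmx_partialE expr0 mul1mx.
by rewrite mxE; exact: is_cvg_expmx.
Qed.

Arguments cvg_expmx_partial : clear implicits.

Lemma cvg_mul_expmx_partial p q (P : 'M[R]_(p, n)) (Q : 'M[R]_(n, q)) A t i j :
  (fun N => (P *m expmx_partial A t N *m Q) i j) @ \oo
    --> (P *m expmx A t *m Q) i j.
Proof.
by apply: cvg_mulmxr; apply: cvg_mulmxl; exact: cvg_expmx_partial.
Qed.

Arguments cvg_mul_expmx_partial [p q] P Q A t i j.

(** Multiplication by a fixed matrix is continuous, so an identity valid for all
    the powers of A extends to e^(tA). *)
Lemma eq_mul_expmx p q (P : 'M[R]_(p, n)) (Q : 'M[R]_(n, q))
    (P' : 'M[R]_(p, n)) (Q' : 'M[R]_(n, q)) A t :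
  (forall k, P *m A ^+ k *m Q = P' *m A ^+ k *m Q') ->
  P *m expmx A t *m Q = P' *m expmx A t *m Q'.
Proof.
move=> eqPQ; apply/matrixP => i j.
have l := cvg_mul_expmx_partial P Q A t i j.
have r := cvg_mul_expmx_partial P' Q' A t i j.
suff E N : P *m expmx_partial A t N *m Q = P' *m expmx_partial A t N *m Q'.
  by move: l; under eq_fun do rewrite E; move=> l;
     exact: (norm_cvg_unique l r).
rewrite /expmx_partial !mulmx_sumr !mulmx_suml; apply: eq_bigr => k _.
by rewrite -!scalemxAr -!scalemxAl eqPQ.
Qed.

Lemma expmx_comm A t : expmx A t *m A = A *m expmx A t.
Proof.
rewrite -[expmx A t]mul1mx -[RHS]mulmx1 mul1mx -[X in X *m A]mul1mx.
apply: eq_mul_expmx => k.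
by rewrite mul1mx mulmx1 !mulmxE -exprS -exprSr.
Qed.

Lemma mul_expmx_eq0 p q (P : 'M[R]_(p, n)) (Q : 'M[R]_(n, q)) A t :
  (forall k, P *m A ^+ k *m Q = 0) -> P *m expmx A t *m Q = 0.
Proof.
move=> PAQ; rewrite (@eq_mul_expmx _ _ P Q 0 0) ?mulmx0// => k.
by rewrite mulmx0.
Qed.

Lemma is_derive_expmx A t i j :
  is_derive t 1 (fun s => expmx A s i j) ((A *m expmx A t) i j).
Proof.
have -> : (A *m expmx A t) i j = limn (pseries (expmx_coef A 1 i j) t).
  apply/esym/cvg_lim => //.
  have -> : pseries (expmx_coef A 1 i j) t =
            (fun N => (A *m expmx_partial A t N) i j).
    by apply/funext => N; rewrite -expmx_partialE expr1.
  by apply: cvg_mulmxl; exact: cvg_expmx_partial.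
have -> : (fun s => expmx A s i j) =
          (fun s => limn (pseries (expmx_coef A 0 i j) s)).
  by apply/funext => s; rewrite mxE.
have d m : pseries_diffs (expmx_coef A m i j) = expmx_coef A m.+1 i j.
  exact: pseries_diffs_expmx.
have tK : `|t| < `| `|t| + 1 | by rewrite [ltRHS]ger0_norm ?ltrDl// addr_ge0.
have := @pseries_snd_diffs R (expmx_coef A 0 i j) (`|t| + 1) t.
by rewrite !d; apply=> //; exact: is_cvg_expmx.
Qed.

Lemma expmx0 A : expmx A 0 = 1%:M.
Proof.
apply/matrixP => i j; have l := cvg_expmx_partial A 0 i j.
suff r : (fun N => expmx_partial A 0 N i j) @ \oo --> (1%:M : 'M[R]_n) i j.
  exact: (norm_cvg_unique l r).
apply: cvg_near_cst; near=> N.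
have N0 : (0 < N)%N by near: N; exists 1%N.
rewrite /expmx_partial big_ltn// big1_seq ?addr0 => [|k /andP[_]].
  by rewrite expr0 fact0 divr1 scale1r expr0.
rewrite mem_index_iota => /andP[k0 _].
by rewrite expr0n gtn_eqF// mul0r scale0r.
Unshelve. all: by end_near. Qed.

End MatrixExponential.

(** * What no control can change *)

Section Conservation.
Context {R : realType}.

(** Cut the interval at the exceptional points and apply the mean value theorem
    on each piece; continuity glues the pieces together. *)
Lemma eq_of_derive0_except (D : seq R) (f : R -> R) (a b : R) :
  a <= b -> {within `[a, b], continuous f} ->
  (forall t, t \in `]a, b[ -> t \notin D -> is_derive t 1 f 0) ->
  f a = f b.
Proof.
elim: D a b => [|d D IHD] a b ab fc f0.
  have [t tab|c _] := @MVT_segment R f (fun=> 0) a b ab _ fc.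
    by apply: f0; rewrite ?in_nil.
  by rewrite mul0r => /eqP; rewrite subr_eq0 => /eqP.
have [/andP[ad db]|dab] := boolP (a < d < b); last first.
  apply: IHD => // t tab tD; apply: f0 => //; rewrite inE negb_or tD andbT.
  by apply: contraNneq dab => <-; move: tab; rewrite in_itv.
have sub c e : a <= c -> e <= b -> {within `[c, e], continuous f}.
  move=> ac eb; apply: continuous_subspaceW fc.
  by apply: subset_itv; rewrite bnd_simp.
have left t : t \in `]a, d[ -> t \notin D -> is_derive t 1 f 0.
  rewrite in_itv/= => /andP[at_ td] tD; apply: f0.
    by rewrite in_itv/= at_ (lt_trans td db).
  by rewrite inE negb_or tD (lt_eqF td).
have right t : t \in `]d, b[ -> t \notin D -> is_derive t 1 f 0.
  rewrite in_itv/= => /andP[dt tb] tD; apply: f0.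
    by rewrite in_itv/= tb (lt_trans ad dt).
  by rewrite inE negb_or tD (gt_eqF dt).
rewrite (IHD a d (ltW ad) (sub _ _ (lexx a) (ltW db)) left).
exact: IHD (ltW db) (sub _ _ (ltW ad) (lexx b)) right.
Qed.

Lemma is_derive_mul_expmx n (v : 'rV[R]_n) (A : 'M[R]_n) (t : R) j :
  is_derive t 1 (fun s => (v *m expmx A s) 0 j) ((v *m A *m expmx A t) 0 j).
Proof.
rewrite -mulmxA mxE.
have -> : (fun s => (v *m expmx A s) 0 j) =
          (fun s => \sum_i v 0 i * expmx A s i j).
  by apply/funext => s; rewrite mxE.
by apply: is_derive_sumr => i; apply: is_deriveZ; exact: is_derive_expmx.
Qed.

(** The row w(t) = v e^((T-t)A) solves the adjoint equation w' = - w A, so that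
    (w x)' = w B u, and w B = v e^((T-t)A) B = 0. This also contains the
    uniqueness of the solutions, without any Gronwall estimate. *)
Lemma trajectory_autonomous N M (A : 'M[R]_N) (B : 'M[R]_(N, M)) (T : R)
    (u : R -> 'cV[R]_M) (x : R -> 'cV[R]_N) (v : 'rV[R]_N) :
  0 <= T -> trajectory A B T u x -> (forall k, v *m A ^+ k *m B = 0) ->
  v *m x T = v *m expmx A T *m x 0.
Proof.
move=> T0 [xc [D xD]] vAB.
pose w (t : R) (j : 'I_N) : R := (v *m expmx A (T - t)) 0 j.
pose f t := \sum_j w t j * x t j 0.
have fE t : (v *m expmx A (T - t) *m x t) 0 0 = f t by rewrite mxE.
have wd (t : R) j : is_derive t 1 (w^~ j) (- (v *m A *m expmx A (T - t)) 0 j).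
  rewrite -mulrN1.
  apply: (@is_derive1_comp _ (fun s => (v *m expmx A s) 0 j) (fun s => T - s)).
    exact: is_derive_mul_expmx.
  by have := is_deriveB (is_derive_cst T t 1) (is_derive_id t (1 : R));
    rewrite sub0r.
have : f 0 = f T.
  apply: (@eq_of_derive0_except D) => //.
    move=> t; apply: cvg_sumr => j; apply: cvgM; last exact: xc.
    have : {within `[0, T], continuous (w^~ j)}.
      apply: continuous_subspaceT => s.
      exact: is_derive_continuous (wd s j).
    exact.
  move=> t tT tD; have [_ xd] := xD t tT tD.
  have df : is_derive t 1 f (\sum_j (w t j * (A *m x t + B *m u t) j 0
       + x t j 0 * - (v *m A *m expmx A (T - t)) 0 j)).
    by apply: is_derive_sumr => j; exact: is_deriveM.
  apply: is_derive_eq df _.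
  rewrite big_split/=.
  under [X in _ + X]eq_bigr do rewrite mulrN mulrC.
  rewrite sumrN.
  transitivity ((v *m expmx A (T - t) *m (A *m x t + B *m u t)
      - v *m A *m expmx A (T - t) *m x t) 0 0).
    by rewrite !mxE; congr (_ - _); apply: eq_bigr => j _; rewrite !mxE.
  have vEB : v *m expmx A (T - t) *m B = 0 by exact: mul_expmx_eq0.
  rewrite mulmxDr !mulmxA vEB mul0mx addr0.
  by rewrite -(mulmxA v) expmx_comm mulmxA subrr mxE.
rewrite -!fE subrr subr0 expmx0 mulmx1 => e.
by apply/matrixP => i j; rewrite !ord1.
Qed.

(** Start at 0 and aim at v itself: the combination v x(T), which stays at 0,
    would have to be the sum of the squares of the entries of v. *)
Lemma controllable_indep N M (A : 'M[R]_N) (B : 'M[R]_(N, M)) (S : {set 'I_N})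
    (v : 'rV[R]_N) :
  simultaneously_controllable A B S -> (forall k, v *m A ^+ k *m B = 0) ->
  (forall i, i \notin S -> v 0 i = 0) -> v = 0.
Proof.
move=> SC vAB vS; have [u [T [x [T0 tr x0 xT]]]] := SC 0 v^T.
have := trajectory_autonomous T0 tr vAB; rewrite x0 mulmx0 => /matrixP/(_ 0 0).
rewrite !mxE => /eqP.
have -> : \sum_j v 0 j * x T j 0 = \sum_j v 0 j ^+ 2.
  apply: eq_bigr => j _; have [jS|jS] := boolP (j \in S).
    by rewrite xT// mxE expr2.
  by rewrite vS// mul0r expr0n.
rewrite psumr_eq0 => [/allP v0|j _]; last exact: sqr_ge0.
apply/matrixP => i j; rewrite ord1 mxE.
by have := v0 j (mem_index_enum j); rewrite /= sqrf_eq0 => /eqP.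
Qed.

End Conservation.

(** * Steering from the origin with polynomial controls *)

Section PolynomialSteering.
Context {F : numFieldType} {N M : nat}.
Variables (A : 'M[F]_N) (B : 'M[F]_(N, M)).

Local Notation "M %:PM" := (map_mx (@polyC F) M) (at level 2, format "M %:PM").
Local Notation "X ^`D" := (map_mx (@deriv F) X) (at level 2, format "X ^`D").
Local Notation "X .@[ a ]" := (map_mx (horner_eval a) X)
  (at level 2, format "X .@[ a ]").

Definition poly_trajectory (X : 'cV[{poly F}]_N) (U : 'cV[{poly F}]_M) :=
  X^`D = A%:PM *m X + B%:PM *m U.

Definition vanish_order (m : nat) (X : 'cV[{poly F}]_N) :=
  forall i k, (k < m)%N -> (X i 0)`_k = 0.

(** A contact of order [m] with the origin at time 0 is kept, with order
    [m - 1], by the derivative of the trajectory. Steering from the origin only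
    requires [m = 1]; larger values feed the induction on the power of A. *)
Definition poly_reachable (m : nat) (xi : 'cV[F]_N) := exists X U,
  [/\ poly_trajectory X U, vanish_order m X & X.@[1] = xi].

Lemma deriv_mulC p q r (C : 'M[F]_(p, q)) (X : 'M[{poly F}]_(q, r)) :
  (C%:PM *m X)^`D = C%:PM *m X^`D.
Proof.
apply/matrixP => i j; rewrite !mxE raddf_sum; apply: eq_bigr => k _.
by rewrite !mxE /= derivM derivC mul0r add0r.
Qed.

Lemma eval_mulC p q r (C : 'M[F]_(p, q)) (X : 'M[{poly F}]_(q, r)) a :
  (C%:PM *m X).@[a] = C *m X.@[a].
Proof.
rewrite map_mxM /=; congr (_ *m _).
by apply/matrixP => i j; rewrite !mxE /horner_eval hornerC.
Qed.

Lemma vanish_order_mulC m (C : 'M[F]_N) X :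
  vanish_order m X -> vanish_order m (C%:PM *m X).
Proof.
move=> Xm i k km; rewrite mxE coef_sum big1// => j _.
by rewrite mxE coefCM Xm// mulr0.
Qed.

Lemma vanish_orderD m X Y :
  vanish_order m X -> vanish_order m Y -> vanish_order m (X + Y).
Proof. by move=> Xm Ym i k km; rewrite mxE coefD Xm// Ym// addr0. Qed.

Lemma poly_reachable0 m : poly_reachable m 0.
Proof.
exists 0, 0; split.
- by rewrite /poly_trajectory !mulmx0 addr0 map_mx0.
- by move=> i k _; rewrite mxE coef0.
- by rewrite map_mx0.
Qed.

Lemma poly_reachableD m xi zeta :
  poly_reachable m xi -> poly_reachable m zeta -> poly_reachable m (xi + zeta).
Proof.
move=> [X [U [XU Xm X1]]] [Z [V [ZV Zm Z1]]]; exists (X + Z), (U + V); split.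
- by rewrite /poly_trajectory map_mxD XU ZV !mulmxDr addrACA.
- exact: vanish_orderD.
- by rewrite map_mxD X1 Z1.
Qed.

(** Closed form: the sum over k < i of phi^(k) A^(i-1-k) b. These are the
    quotients of D^i - A^i by D - A, where D is differentiation, applied to
    phi b. *)
Fixpoint flat_state (phi : {poly F}) (b : 'cV[F]_N) (i : nat) :
    'cV[{poly F}]_N :=
  if i is j.+1 then A%:PM *m flat_state phi b j + phi^`(j) *: b%:PM else 0.

Lemma deriv_scaleC (p : {poly F}) (b : 'cV[F]_N) :
  (p *: b%:PM)^`D = p^`() *: b%:PM.
Proof.
by apply/matrixP => i j; rewrite !mxE /= derivM derivC mulr0 addr0.
Qed.

Lemma eval_scaleC (p : {poly F}) (b : 'cV[F]_N) a :
  (p *: b%:PM).@[a] = p.[a] *: b.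
Proof. by apply/matrixP => i j; rewrite !mxE /horner_eval hornerM hornerC. Qed.

(** The operator identity (D - A) (sum of D^k A^(i-1-k)) = D^i - A^i, rearranged
    so that A appears only through the next state. *)
Lemma deriv_flat_state phi b i :
  (flat_state phi b i)^`D = flat_state phi b i.+1 - phi *: (A ^+ i *m b)%:PM.
Proof.
elim: i => [|i IHi].
  by rewrite /= map_mx0 mulmx0 add0r expr0 mul1mx subrr.
rewrite [flat_state _ _ i.+1]/= map_mxD deriv_mulC IHi deriv_scaleC -derivnS.
rewrite mulmxBr addrAC; congr (_ - _).
by rewrite -scalemxAr -map_mxM /= mulmxA mulmxE -exprS.
Qed.

Lemma vanish_flat_state (phi : {poly F}) b m n i :
  (forall k, (k < n)%N -> phi`_k = 0) -> (m + i <= n)%N ->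
  vanish_order m (flat_state phi b i).
Proof.
move=> phin; elim: i => [|i IHi] mi; first by move=> j k _; rewrite mxE coef0.
apply: vanish_orderD; first by apply/vanish_order_mulC/IHi; lia.
move=> j k km; rewrite !mxE coefMC coef_derivn phin ?mul0rn ?mul0r//; lia.
Qed.

(** In the closed form of the state of index i + 1, the derivative of highest
    order, i, is the one that multiplies b itself. *)
Lemma eval_flat_state phi b i :
  (forall k, (k < i)%N -> phi^`(k).[1] = 0) ->
  (flat_state phi b i).@[1] = 0 /\
  (flat_state phi b i.+1).@[1] = phi^`(i).[1] *: b.
Proof.
move=> phi1.
have evS k : (flat_state phi b k.+1).@[1] =
             A *m (flat_state phi b k).@[1] + phi^`(k).[1] *: b.
  by rewrite map_mxD eval_mulC eval_scaleC.
have ev0 : (flat_state phi b i).@[1] = 0.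
  elim: i phi1 => [|i IHi] phi1; first by rewrite map_mx0.
  rewrite evS phi1// scale0r addr0 IHi ?mulmx0// => k ki.
  by rewrite phi1// ltnW.
by split; rewrite // evS ev0 mulmx0 add0r.
Qed.

(** Taylor expansion at a, by induction: the derivative of q (X - a)^(n+1) has
    the form q1 (X - a)^n with q1(a) = (n + 1) q(a). *)
Lemma derivn_mul_XsubC_exp (q : {poly F}) (a : F) n :
  (forall k, (k < n)%N -> (q * ('X - a%:P) ^+ n)^`(k).[a] = 0) /\
  (q * ('X - a%:P) ^+ n)^`(n).[a] = n`!%:R * q.[a].
Proof.
elim: n q => [|n IHn] q; first by rewrite expr0 mulr1 derivn0 fact0 mul1r.
have dq : (q * ('X - a%:P) ^+ n.+1)^`() =
    (q^`() * ('X - a%:P) + q *+ n.+1) * ('X - a%:P) ^+ n.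
  rewrite derivM deriv_exp derivB derivX derivC subr0 mul1r exprS /=.
  by rewrite [RHS]mulrDl mulrA mulrnAr mulrnAl.
have [IHlt IHeq] := IHn (q^`() * ('X - a%:P) + q *+ n.+1).
split=> [[|k] kn|].
- by rewrite derivn0 exprS !hornerM hornerXsubC subrr mul0r mulr0.
- by rewrite derivSn dq IHlt.
- rewrite derivSn dq IHeq hornerD hornerM hornerXsubC hornerMn subrr mulr0.
  by rewrite add0r factS natrM; ring.
Qed.

(** Cayley-Hamilton, in a form that also covers dimension 0. *)
Lemma pow_dim_comb : exists c : 'I_N -> F, A ^+ N = \sum_(k < N) c k *: A ^+ k.
Proof.
case: N A => [|n] C; first by exists (fun=> 0); apply/matrixP => -[].
pose p := char_poly C; exists (fun k => - p`_k).
have hmx k : horner_mx C (p`_k *: 'X^k) = p`_k *: C ^+ k.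
  by rewrite linearZ rmorphXn /= horner_mx_X.
have : horner_mx C p = 0 by exact: Cayley_Hamilton.
rewrite -{1}[p]coefK poly_def size_char_poly.
rewrite big_ord_recr raddfD raddf_sum /= hmx.
have -> : p`_n.+1 = 1.
  by have /monicP := char_poly_monic C; rewrite /lead_coef size_char_poly.
rewrite scale1r => /addr0_eq <-; rewrite -sumrN.
by apply: eq_bigr => k _; rewrite hmx scaleNr.
Qed.

(** Let p(z) = z^N - sum of c_k z^k be a polynomial that annihilates A, and let
    b = B w. Combining the flat states of index 0, ..., N with the coefficients
    of p gives X with X' - A X = p(D) phi b - phi p(A) b = p(D) phi b, so the
    control is p(D) phi w. The polynomial phi vanishes to high order at 0, and
    at 1 its derivatives of order 0, ..., N - 1 are 0, ..., 0, 1, so that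
    X(1) = b. *)
Lemma poly_reachable_input m (w : 'cV[F]_M) : poly_reachable m (B *m w).
Proof.
case: (posnP N) => [N0|N0].
  suff -> : B *m w = 0 by exact: poly_reachable0.
  by apply/matrixP => i; move: (leq_trans (ltn_ord i) (eq_leq N0)).
have [c cA] := pow_dim_comb.
pose q : {poly F} := ((N.-1)`!%:R^-1)%:P * 'X^(m + N).
pose phi := q * ('X - 1%:P) ^+ N.-1.
have [phi_lt phi_eq] := derivn_mul_XsubC_exp q 1 N.-1.
have phi_dim : phi^`(N.-1).[1] = 1.
  by rewrite phi_eq /q hornerM hornerC hornerXn expr1n mulr1 mulfV// pnatr_eq0.
have phi0 k : (k < m + N)%N -> phi`_k = 0.
  by move=> km; rewrite /phi /q mulrAC coefMXn km.
pose b := B *m w; pose X := flat_state phi b.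
exists (X N - \sum_(k < N) (c k)%:P *: X k).
exists ((phi^`(N) - \sum_(k < N) (c k)%:P * phi^`(k)) *: w%:PM); split.
- rewrite /poly_trajectory.
  have -> : (X N - \sum_(k < N) (c k)%:P *: X k)^`D =
      X N.+1 - \sum_(k < N) (c k)%:P *: X k.+1.
    have AN : phi *: (A ^+ N *m b)%:PM =
        \sum_(k < N) (c k)%:P *: (phi *: (A ^+ k *m b)%:PM).
      rewrite cA mulmx_suml map_mx_sum scaler_sumr; apply: eq_bigr => k _.
      by rewrite -scalemxAl map_mxZ /= !scalerA mulrC.
    rewrite map_mxB deriv_flat_state map_mx_sum AN -addrA -opprD -big_split /=.
    congr (_ - _); apply: eq_bigr => k _.
    have -> : ((c k)%:P *: X k)^`D = (c k)%:P *: (X k)^`D.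
      by apply/matrixP => i j; rewrite !mxE /= derivM derivC mul0r add0r.
    by rewrite deriv_flat_state -scalerDr addrC subrK.
  have XS k : X k.+1 = A%:PM *m X k + phi^`(k) *: b%:PM by [].
  rewrite XS mulmxBr mulmx_sumr -scalemxAr -map_mxM /= scalerBl scaler_suml.
  rewrite addrACA -opprD -big_split /=; congr (_ - _); apply: eq_bigr => k _.
  by rewrite XS scalerDr -scalemxAr scalerA.
- have vX l : (l <= N)%N -> vanish_order m (X l).
    by move=> lN; apply: vanish_flat_state phi0 _; rewrite leq_add2l.
  move=> i k km; rewrite !mxE summxE coefB coef_sum vX// big1 ?subr0// => l _.
  by rewrite mxE coefCM vX ?mulr0// ltnW.
- rewrite map_mxB map_mx_sum.
  rewrite -[N in X N](prednK N0) (eval_flat_state b phi_lt).2 phi_dim scale1r.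
  rewrite big1 ?subr0// => k _.
  rewrite map_mxZ /X (eval_flat_state b _).1 ?scaler0// => l lk.
  by apply: phi_lt; have := ltn_ord k; lia.
Qed.

(** Since the system does not depend on time, the derivative of a trajectory is
    the trajectory of the derivative of its control. It ends at A xi + B U(1),
    and the second term is removed by [poly_reachable_input]; one order of
    contact at 0 is spent. *)
Lemma poly_reachable_step m xi :
  poly_reachable m.+1 xi -> poly_reachable m (A *m xi).
Proof.
move=> [X [U [XU Xm X1]]].
rewrite -[A *m xi](addrK (B *m U.@[1])) -mulmxN.
apply: poly_reachableD; last exact: poly_reachable_input.
exists X^`D, U^`D; split.
- by rewrite /poly_trajectory {1}XU map_mxD !deriv_mulC.
- by move=> i k km; rewrite mxE /= coef_deriv Xm// mul0rn.
- by rewrite XU map_mxD !eval_mulC X1.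
Qed.

Lemma poly_reachable_pow m k (w : 'cV[F]_M) :
  poly_reachable m (A ^+ k *m B *m w).
Proof.
elim: k m => [|k IHk] m.
  by rewrite expr0 mul1mx; exact: poly_reachable_input.
by rewrite exprS -mulmxE -!mulmxA; apply: poly_reachable_step; rewrite mulmxA.
Qed.

End PolynomialSteering.

(** * Rank and dimension of the column space *)

Section LinearAlgebra.
Context {F : fieldType}.

Lemma mulmx_cols m n (P : 'M[F]_(m, n)) (w : 'cV[F]_n) :
  P *m w = \sum_j w j 0 *: col j P.
Proof.
apply/matrixP => i k; rewrite ord1 summxE mxE; apply: eq_bigr => j _.
by rewrite !mxE mulrC.
Qed.

(** The columns of P span the same space as the rank P columns of its column
    base, which are free because the column base has a left inverse. *)
Lemma dim_span_cols m n (P : 'M[F]_(m, n)) :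
  \dim <<[seq col j P | j : 'I_n]>>%VS = \rank P.
Proof.
have memP n' (Q : 'M[F]_(m, n')) w :
    Q *m w \in <<[seq col j Q | j : 'I_n']>>%VS.
  rewrite mulmx_cols; apply: memv_suml => j _; apply/memvZ/memv_span.
  by apply: map_f; rewrite mem_enum.
have subP n1 n2 (P1 : 'M[F]_(m, n1)) (P2 : 'M[F]_(m, n2)) G : P1 = P2 *m G ->
    (<<[seq col j P1 | j : 'I_n1]>> <= <<[seq col j P2 | j : 'I_n2]>>)%VS.
  by move=> ->; apply/span_subvP => _ /mapP[j _ ->]; rewrite colE -mulmxA.
pose Q := col_base P.
have /row_freeP[G rG] := row_base_free P.
have -> : <<[seq col j P | j : 'I_n]>>%VS =
          <<[seq col j Q | j : 'I_(\rank P)]>>%VS.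
  apply: subv_anti; rewrite (subP _ _ _ _ (row_base P)) ?mulmx_base//=.
  apply: (subP _ _ _ _ G); have := congr1 (mulmx^~ G) (mulmx_base P).
  by rewrite /= -mulmxA rG mulmx1.
pose X := [tuple col j Q | j < \rank P].
have -> : [seq col j Q | j : 'I_(\rank P)] = X by [].
suff : free X by rewrite /free size_tuple => /eqP.
apply/freeP => k k0 i.
have /row_fullP[L LQ] := col_base_full P.
have : Q *m (\col_j k j) = 0.
  rewrite mulmx_cols -[RHS]k0; apply: eq_bigr => j _.
  by rewrite mxE -tnth_nth tnth_mktuple.
move/(congr1 (mulmx L)); rewrite mulmxA LQ mul1mx mulmx0.
by move/matrixP/(_ i 0); rewrite !mxE.
Qed.

End LinearAlgebra.

(** * Controllable sets and independent rows *)

Section Controllability.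
Context {R : realType} {N M : nat}.
Variables (A : 'M[R]_N) (B : 'M[R]_(N, M)).

Local Notation K := (controllability_matrix A B).

Lemma kernel_controllability (v : 'rV[R]_N) :
  v *m K = 0 -> forall k, v *m A ^+ k *m B = 0.
Proof.
rewrite /controllability_matrix mul_mxrow => vK.
have vlt (k : 'I_N) : v *m A ^+ k *m B = 0.
  have := congr1 (fun X => submxrow X k) vK.
  by rewrite /= mxrowK mulmxA submxrow0.
elim/ltn_ind => k IHk; have [kN|Nk] := ltnP k N.
  exact: (vlt (Ordinal kN)).
have [c cA] := pow_dim_comb A.
rewrite -(subnKC Nk) exprD cA mulr_suml mulmx_sumr mulmx_suml big1// => j _.
rewrite -mulmxE -scalemxAl mulmxE -exprD -scalemxAr -scalemxAl IHk ?scaler0//.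
by have := ltn_ord j; lia.
Qed.

Lemma poly_reachable_range m (w : 'cV[R]_(\sum_(k < N) M)) :
  poly_reachable A B m (K *m w).
Proof.
rewrite -[w]submxcolK mul_mxrow_mxcol.
elim/big_ind: _ => [|x y|k _]; first exact: poly_reachable0.
  exact: poly_reachableD.
exact: poly_reachable_pow.
Qed.

(** Superposition of the free motion from x0 and of a polynomial trajectory from
    0 to xi. *)
Lemma steer xi x0 : poly_reachable A B 1 xi ->
  exists u x, [/\ trajectory A B 1 u x, x 0 = x0 & x 1 = expmx A 1 *m x0 + xi].
Proof.
move=> [X [U [XU X0 X1]]].
exists (fun t => map_mx (horner_eval t) U).
exists (fun t => expmx A t *m x0 + map_mx (horner_eval t) X); split; last first.
- by rewrite X1.
- rewrite expmx0 mul1mx -[RHS]addr0; congr (_ + _).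
  by apply/matrixP => i j; rewrite ord1 !mxE /horner_eval horner_coef0 X0.
have xd (t : R) i : is_derive t 1
    (fun s => (expmx A s *m x0 + map_mx (horner_eval s) X) i 0)
    ((A *m (expmx A t *m x0 + map_mx (horner_eval t) X)
      + B *m map_mx (horner_eval t) U) i 0).
  have -> : (fun s => (expmx A s *m x0 + map_mx (horner_eval s) X) i 0) =
      (fun s => \sum_j x0 j 0 * expmx A s i j) + horner (X i 0).
    apply/funext => s; rewrite !mxE; congr (_ + _).
    by apply: eq_bigr => j _; rewrite mulrC.
  have -> : (A *m (expmx A t *m x0 + map_mx (horner_eval t) X)
      + B *m map_mx (horner_eval t) U) i 0 =
      \sum_j x0 j 0 * (A *m expmx A t) i j + (X i 0)^`().[t].
    have Xt : map_mx (horner_eval t) (map_mx deriv X) =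
        A *m map_mx (horner_eval t) X + B *m map_mx (horner_eval t) U.
      by rewrite XU map_mxD !eval_mulC.
    rewrite mulmxDr -addrA -Xt mulmxA mxE; congr (_ + _); last by rewrite !mxE.
    by rewrite mxE; apply: eq_bigr => j _; rewrite mulrC.
  apply: is_deriveD.
  by apply: is_derive_sumr => j; apply: is_deriveZ; exact: is_derive_expmx.
split=> [i|].
  by apply: continuous_subspaceT => t; exact: is_derive_continuous (xd t i).
exists [::] => t _ _; split=> // j.
have -> : (fun s => map_mx (horner_eval s) U j 0) = horner (U j 0).
  by apply/funext => s; rewrite mxE.
exact: is_derive_continuous (is_derive_poly _ _).
Qed.

(** The free motion shifts the target by a fixed vector, and the targets on S
    are arbitrary; hence the origin may be taken as the initial state. *)
Lemma controllable_of_reachable (S : {set 'I_N}) :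
  (forall y : 'cV[R]_N, exists2 xi, poly_reachable A B 1 xi &
     forall i, i \in S -> xi i 0 = y i 0) ->
  simultaneously_controllable A B S.
Proof.
move=> reach x0 xbar; have [xi rxi xiS] := reach (xbar - expmx A 1 *m x0).
have [u [x [tr x00 x1]]] := steer x0 rxi.
exists u, 1, x; split=> // i iS.
by rewrite x1 mxE xiS// [X in _ + X]mxE [X in _ + (_ + X)]mxE addrC subrK.
Qed.

(** A linear relation between the rows of K indexed by S, extended by 0 outside
    S, is a vector to which [controllable_indep] applies. *)
Lemma controllable_card_le (S : {set 'I_N}) :
  simultaneously_controllable A B S -> (#|S| <= \rank K)%N.
Proof.
move=> SC.
pose f (i : 'I_#|S|) : 'I_N := enum_val i.
have : row_free (rowsub f K).
  apply: inj_row_free => u uK.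
  pose v := u *m rowsub f 1%:M.
  have vE j : v 0 j = \sum_i u 0 i *+ (f i == j).
    by rewrite mxE; apply: eq_bigr => i _; rewrite !mxE mulr_natr.
  have vf i : v 0 (f i) = u 0 i.
    rewrite vE (bigD1 i)//= eqxx mulr1n big1 ?addr0// => l li.
    by rewrite (inj_eq enum_val_inj) (negPf li).
  have v0 : v = 0.
    apply: (controllable_indep SC).
      by apply: kernel_controllability; rewrite -mulmxA -rowsubE.
    move=> j jS; rewrite vE big1// => i _; case: eqP => // fij.
    by move: jS; rewrite -fij enum_valP.
  by apply/matrixP => i j; rewrite ord1 -vf v0 !mxE.
move=> /eqP <-; rewrite rowsubE; exact: mxrankM_maxr.
Qed.

(** Take a maximal independent family of rows of K; a right inverse of the
    matrix that they form solves for the control parameters. *)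
Lemma controllable_rank_many :
  exists2 S : {set 'I_N}, simultaneously_controllable A B S & #|S| = \rank K.
Proof.
pose f := maxrankfun K.
exists [set f i | i : 'I_(\rank K)]; last first.
  by rewrite card_imset ?card_ord//; exact: maxrankfun_inj.
have /row_freeP[G KG] := maxrowsub_free K.
apply: controllable_of_reachable => y.
exists (K *m (G *m rowsub f y)); first exact: poly_reachable_range.
move=> _ /imsetP[i _ ->].
have : rowsub f K *m (G *m rowsub f y) = rowsub f y.
  by rewrite mulmxA KG mul1mx.
by rewrite mul_rowsub_mx => /matrixP/(_ i 0); rewrite !mxE.
Qed.

Lemma card_controllable_nodes (C : {set 'I_N}) :
  controllable_nodes A B C -> #|C| = \dim (controllable_subspace A B).
Proof.
move=> [CC Cmax]; rewrite dim_span_cols; apply/eqP.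
have [S SC Sr] := controllable_rank_many.
by rewrite eqn_leq controllable_card_le//= -Sr Cmax.
Qed.

End Controllability.

(** * A network with two maximal controllable sets *)

Section Star.
Context {R : realType}.

(** Node 0 drives nodes 1 and 2 along edges of equal weight, so that
    x_1 - x_2 never changes. *)
Definition star_dynamics : 'M[R]_3 :=
  \matrix_(i, j) ((i != 0) && (j == 0))%:R.

Definition star_input : 'M[R]_(3, 1) := delta_mx 0 0.

Lemma star_controllable (i : 'I_3) : i != 0 ->
  simultaneously_controllable star_dynamics star_input [set 0; i]%SET.
Proof.
move=> i0; apply: controllable_of_reachable => y.
exists (star_input *m (y 0 0)%:M +
        star_dynamics ^+ 1 *m star_input *m (y i 0)%:M).
  by apply: poly_reachableD; [exact: poly_reachable_input|
                              exact: poly_reachable_pow].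
have xiE j : (star_input *m (y 0 0)%:M + star_dynamics ^+ 1 *m star_input *m
    (y i 0)%:M) j 0 = if j == 0 then y 0 0 else y i 0.
  rewrite expr1 !mul_mx_scalar -colE !mxE !eqxx !andbT.
  by case: (j == 0); rewrite ?mulr1 ?mulr0 ?addr0 ?add0r.
move=> j; rewrite !inE xiE => /orP[/eqP->//|/eqP->].
by rewrite (negPf i0).
Qed.

(** The row v = e_1 - e_2 satisfies v A = 0 and v B = 0: the quantity x_1 - x_2
    is conserved. *)
Lemma star_card_le (S : {set 'I_3}) :
  simultaneously_controllable star_dynamics star_input S -> (#|S| <= 2)%N.
Proof.
move=> SC; rewrite leqNgt; apply/negP => S3.
have ST : S = [set: 'I_3]%SET.
  by apply/eqP; rewrite eqEcard finset.subsetT finset.cardsT card_ord.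
pose v : 'rV[R]_3 := delta_mx 0 1 - delta_mx 0 2.
have vA : v *m star_dynamics = 0.
  rewrite mulmxBl -!rowE; apply/matrixP => i j; rewrite !mxE.
  by rewrite subrr.
have vB : v *m star_input = 0.
  rewrite mulmxBl -!rowE; apply/matrixP => i j; rewrite !mxE.
  by rewrite subrr.
have v0 : v = 0.
  apply: (controllable_indep SC) => [[|k]|j]; last by rewrite ST inE.
    by rewrite expr0 mulmx1.
  by rewrite exprS -mulmxE mulmxA vA !mul0mx.
move/matrixP/(_ 0 1): v0; rewrite !mxE /= subr0 => /eqP.
by rewrite oner_eq0.
Qed.

Lemma star_controllable_nodes (i : 'I_3) : i != 0 ->
  controllable_nodes star_dynamics star_input [set 0; i]%SET.
Proof.
move=> i0; split=> [|S /star_card_le]; first exact: star_controllable.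
by rewrite cards2 eq_sym i0.
Qed.

End Star.

Theorem proposition1 (R : realType) :
  (forall (N M : nat) (A : 'M[R]_N) (B : 'M[R]_(N, M)),
      one_nonzero_per_column B ->
      forall C : {set 'I_N}, controllable_nodes A B C ->
        #|C| = \dim (controllable_subspace A B)) /\
  (exists (N M : nat) (A : 'M[R]_N) (B : 'M[R]_(N, M)),
      one_nonzero_per_column B /\
      exists C1 C2 : {set 'I_N},
        [/\ controllable_nodes A B C1, controllable_nodes A B C2 & C1 <> C2]).
Proof.
split=> [N M A B _ C|]; first exact: card_controllable_nodes.
exists 3%N, 1%N, star_dynamics, star_input; split=> [j|].
  rewrite (_ : [set i | _]%SET = [set 0]%SET) ?cards1//.
  apply/setP => i; rewrite !inE !mxE !ord1 andbT.
  by case: (i == 0); rewrite ?oner_eq0 ?eqxx.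
exists [set 0; 1]%SET, [set 0; 2]%SET; split.
- exact: star_controllable_nodes.
- exact: star_controllable_nodes.
- by move/setP/(_ 1); rewrite !inE.
Qed.
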